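(* Let $A\subset\mathbb{R}$ be a finite set with $|A|\ge 2$. Then there exist $a,a'\in A$ such that \[ |2(a+A)^3+2(a'+A)^3-2(a+A)^3-(a'+A)^3| \gtrsim |A|^{5/2}. \]
   Context: For $a\in\mathbb{R}$ and $A \subset \mathbb{R}$, $(a+A)^3=\{(a+x)^3:x\in A\}$ (the set of cubes of elements of $a+A$). For sets $S,T\subset\mathbb{R}$, $S+T=\{s+t: s \in S, t \in T\}$, $S-T=\{s-t: s \in S, t \in T\}$, and $2S=S+S$; thus the set in the claim consists of all sums $u_1+u_2+v_1+v_2-u_3-u_4-v_3$ with $u_i\in(a+A)^3$, $v_i\in(a'+A)^3$. $|\cdot|$ is cardinality. $X\gtrsim Y$ means that there are absolute constants $C,c>0$ such that $X\ge C\,Y/(\log_2 Y)^c$. *)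

(* Defs.v *)
From mathcomp Require Import all_boot all_order all_algebra.
From mathcomp Require Import finmap.
From mathcomp Require Import reals exp.

Set Implicit Arguments.
Unset Strict Implicit.
Unset Printing Implicit Defensive.

Import Order.TTheory GRing.Theory Num.Theory.

Local Open Scope fset_scope.
Local Open Scope ring_scope.

Section Sumsets.
Variable R : realType.
Implicit Types (S T A : {fset R}) (a : R).

Definition sumset S T : {fset R} := [fset s + t | s in S, t in T].

Definition diffset S T : {fset R} := [fset s - t | s in S, t in T].

(* 2S is the sumset S + S, not the dilate {2s : s in S}. *)
Definition dblset S : {fset R} := sumset S S.

Definition cubes a A : {fset R} := [fset (a + x) ^+ 3 | x in A].

End Sumsets.

Notation "S :+: T" := (sumset S T)
  (at level 50, left associativity) : fset_scope.
Notation "S :-: T" := (diffset S T)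
  (at level 50, left associativity) : fset_scope.
Section Gtrsim.
Variable R : realType.

Definition log2 (y : R) : R := ln y / ln 2.

(* X >~ Y with the implied constants C and c made explicit, so that
   statements can quantify them before everything else (absolute constants).
   Meant for Y > 1, where log2 Y > 0. *)
Definition gtrsim (C c X Y : R) : Prop := C * Y / (log2 Y `^ c) <= X.

End Gtrsim.

(* Main.v *)
(** Let x_0 < x_1 < ... be the nonnegative elements of A (or of -A), and for
    consecutive a = x_j, a' = x_(j+1) put f(y) = (a + y)^3 and
    g(y) = (a' + y)^3 - (a + y)^3, a quadratic polynomial in y.  The numbers
      u = f(x_i) + g(x_k) + g(x_(l+1)) - g(x_l)
    belong to the set in question.  Put d_l = g(x_(l+1)) - g(x_l).  If
    d_l <= d_k, x_(k+1) <= x_i and a' - a <= x_(i+1) - x_i, then u is squeezed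
    into (f(x_i), f(x_(i+1))], which determines i; then u - f(x_i) is squeezed
    into (g(x_k), g(x_(k+1))], which determines k; and then d_l is determined.
    Two indices l give the same d_l for at most one j, so for some j there are
    few coincidences among the d_l and many large gaps x_(i+1) - x_i.  This
    yields >> |A|^3 distinct values u, more than needed. *)
Require Import Defs.
From mathcomp Require Import all_boot all_order all_algebra.
From mathcomp Require Import finmap.
From mathcomp Require Import reals exp.
From mathcomp Require Import zify ring lra.

Set Implicit Arguments.
Unset Strict Implicit.
Unset Printing Implicit Defensive.

Import Order.TTheory GRing.Theory Num.Theory.

Local Open Scope fset_scope.
Local Open Scope ring_scope.

(** * Counting and order lemmas *)

(** The order is total, so these pairs and their mirror images cover [A] x [A]. *)
Lemma card_sqr_le_ordered_pairs (R : realDomainType) (T : finType) (v : T -> R)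
    (A : {set T}) :
  (#|A| ^ 2 <= 2 * #|[set p in setX A A | (v p.1 <= v p.2)%R]|)%N.
Proof.
set Q := [set p in _ | _].
have cQ : #|[set (p.2, p.1) | p in Q]| = #|Q|.
  by apply: card_imset => -[a b] [c d] /= [-> ->].
rewrite mul2n -addnn -{2}cQ -mulnn -cardsX.
apply: leq_trans (leq_card_setU _ _); apply/subset_leq_card/subsetP => -[a b].
rewrite in_setX in_setU /= => /andP[aA bA].
have [ab|/ltW ba] := leP (v a) (v b); first by rewrite !inE aA bA ab.
by apply/orP; right; apply/imsetP; exists (b, a); rewrite // !inE /= aA bA.
Qed.

Lemma sum_card_exchange (I J : finType) (Q : I -> J -> bool) :
  (\sum_i #|[set j | Q i j]| = \sum_j #|[set i | Q i j]|)%N.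
Proof.
under eq_bigr do rewrite -sum1dep_card big_mkcond.
under [RHS]eq_bigr do rewrite -sum1dep_card big_mkcond.
exact: exchange_big.
Qed.

Lemma eq_index_of_mem_gap (R : realDomainType) (n : nat) (w : nat -> R) (t : R)
    (i j : nat) :
  (forall k l, (k <= l <= n)%N -> w k <= w l) ->
  (i < n)%N -> (j < n)%N ->
  w i < t <= w i.+1 -> w j < t <= w j.+1 -> i = j.
Proof.
move=> w_le i_n j_n /andP[it ti] /andP[jt tj].
have [ij|ji|//] := ltngtP i j.
- have := w_le i.+1 j; rewrite ij (ltnW j_n) => /(_ isT).
  by move=> /(le_trans ti) /(lt_le_trans jt); rewrite ltxx.
- have := w_le j.+1 i; rewrite ji (ltnW i_n) => /(_ isT).
  by move=> /(le_trans tj) /(lt_le_trans it); rewrite ltxx.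
Qed.

(** * Squeezing along an increasing nonnegative sequence *)

Section Squeezing.
Variables (R : realFieldType) (m : nat) (x : nat -> R).
Hypothesis x_ge0 : forall i, (i <= 7 * m)%N -> 0 <= x i.
Hypothesis x_lt : forall i j, (i < j <= 7 * m)%N -> x i < x j.

Let gap i := x i.+1 - x i.
Let f j (y : R) := (x j + y) ^+ 3.
Let g j (y : R) := f j.+1 y - f j y.
Let d j l := g j (x l.+1) - g j (x l).

Lemma x_le i j : (i <= j <= 7 * m)%N -> x i <= x j.
Proof.
move=> /andP[]; rewrite leq_eqVlt => /predU1P[-> //|ij] j7.
by apply/ltW/x_lt; rewrite ij.
Qed.

Lemma f_mono j y z : (j <= 7 * m)%N -> 0 <= y -> y <= z -> f j y <= f j z.
Proof.
move=> /x_ge0 xj y0 yz; rewrite /f lerXn2r ?nnegrE ?addr_ge0 ?lerD2l //.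
exact: le_trans yz.
Qed.

Lemma d_factor j l :
  d j l = 3 * gap j * gap l * ((x l + x l.+1) + (x j + x j.+1)).
Proof. by rewrite /d /g /f /gap; ring. Qed.

Lemma gap_gt0 i : (i < 7 * m)%N -> 0 < gap i.
Proof. by move=> i7; rewrite subr_gt0 x_lt // ltnSn. Qed.

Lemma d_gt0 j l : (j < 7 * m)%N -> (l < 7 * m)%N -> 0 < d j l.
Proof.
move=> j7 l7.
rewrite d_factor mulr_gt0 ?mulr_gt0 ?gap_gt0 //.
have := x_ge0 (ltnW l7); have := gap_gt0 l7; have := x_ge0 (ltnW j7).
have := x_ge0 j7; rewrite /gap; lra.
Qed.

(* [d j l = d j l'] is a linear equation in [x j + x j.+1]. *)
Lemma d_coincidence_uniq j j' l l' :
  (j < 7 * m)%N -> (j' < 7 * m)%N -> (l' < l < m)%N ->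
  d j l' = d j l -> d j' l' = d j' l -> j = j'.
Proof.
move=> j7 j'7 /andP[l'l lm]; rewrite !d_factor.
have gj := gap_gt0 j7; have gj' := gap_gt0 j'7.
have gl : 0 < gap l by apply: gap_gt0; lia.
have xll' : x l' < x l by apply: x_lt; lia.
have xSll' : x l'.+1 < x l.+1 by apply: x_lt; lia.
have nz3 : 3 != 0 :> R by rewrite pnatr_eq0.
rewrite -!mulrA => /(mulfI nz3)/(mulfI (lt0r_neq0 gj)) e1.
move=> /(mulfI nz3)/(mulfI (lt0r_neq0 gj')) e2.
(* Subtracting [e2] from [e1] leaves ([gap l'] - [gap l]) times the difference of the two sides.
   Equal gaps would turn [e1] into x_l + x_(l+1) = x_l' + x_(l'+1), impossible for l' < l. *)
have xE : x j + x j.+1 = x j' + x j'.+1.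
  apply: (mulfI (x := gap l' - gap l)); last by lra.
  apply/negP; rewrite subr_eq0 => /eqP gE; move: e1; rewrite gE.
  by move=> /(mulfI (lt0r_neq0 gl)); lra.
have [jj'|j'j|//] := ltngtP j j'.
- have xj : x j < x j' by apply: x_lt; lia.
  have xSj : x j.+1 < x j'.+1 by apply: x_lt; lia.
  by exfalso; lra.
- have xj : x j' < x j by apply: x_lt; lia.
  have xSj : x j'.+1 < x j.+1 by apply: x_lt; lia.
  by exfalso; lra.
Qed.

(* The indices [k] and [l] are taken below [m], the indices [i] and [j] in
   [m, 7 * m), so that there are many more choices of [j] than of [l]. *)
Let large_gaps j := [set i : 'I_(6 * m) | gap j <= gap (m + i)].
Let coincidences j :=
  [set p : 'I_m * 'I_m | (p.1 < p.2)%N && (d j p.1 == d j p.2)].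
(** Keeping only the least index for each value makes [d j] injective. *)
Let first_indices j :=
  [set l : 'I_m | [forall k : 'I_m, (k < l)%N ==> (d j k != d j l)]].

(** Each discarded index is the second component of some coincidence. *)
Lemma card_first_indices j : (m <= #|first_indices j| + #|coincidences j|)%N.
Proof.
rewrite -[leqLHS](card_ord m) -(cardsC (first_indices j)) leq_add2l.
apply: leq_trans (leq_imset_card snd _).
apply/subset_leq_card/subsetP => l; rewrite !inE negb_forall => /existsP[k].
rewrite negb_imply negbK => kl.
by apply/imsetP; exists (k, l); rewrite ?inE.
Qed.

(** Average over the 6m values of [j] in [m, 7m). Comparing gaps pairwise, the sets [large_gaps j]
    have total size at least (6m)^2 / 2, while all coincidences together number at most m^2. Summed
    over [j], the left side is thus at most 18m^2 + 18m^2 = 36m^2, and the right side is at least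
    that. *)
Lemma exists_good_gap : (0 < m)%N ->
  exists2 j, (j < 7 * m)%N &
    (18 * #|coincidences j| + 3 * m <= 2 * #|large_gaps j|)%N.
Proof.
move=> m0.
have [/existsP[j jP]|] := boolP [exists j : 'I_(6 * m),
    18 * #|coincidences (m + j)| + 3 * m <= 2 * #|large_gaps (m + j)|]%N.
  by exists (m + j)%N => //; have := ltn_ord j; lia.
rewrite negb_exists => /forallP few.
have : (\sum_(j < 6 * m) (2 * #|large_gaps (m + j)|).+1 <=
        \sum_(j < 6 * m) (18 * #|coincidences (m + j)| + 3 * m))%N.
  by apply: leq_sum => j _; have := few j; rewrite -ltnNge.
under eq_bigr do rewrite -addn1.
rewrite big_split [leqRHS]big_split -!big_distrr /= !sum_nat_const !card_ord.
have : (\sum_(j < 6 * m) #|coincidences (m + j)| <= m * m)%N.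
  rewrite sum_card_exchange -[leqRHS]muln1 -[in leqRHS](card_ord m).
  rewrite -card_prod -sum_nat_const; apply: leq_sum => -[l' l] _ /=.
  apply/card_le1_eqP => j' j; rewrite !inE.
  move=> /andP[/= ll /eqP e'] /andP[_ /eqP e].
  apply/val_inj/eqP; rewrite -(eqn_add2l m); apply/eqP.
  by apply: (d_coincidence_uniq _ _ _ e e'); rewrite ?ll ?ltn_ord //;
    [have := ltn_ord j|have := ltn_ord j']; lia.
have := card_sqr_le_ordered_pairs (fun j : 'I_(6 * m) => gap (m + j)) setT.
rewrite cardsT card_ord.
have -> : (#|[set p : 'I_(6 * m) * 'I_(6 * m) in setX setT setT |
    (gap (m + p.1) <= gap (m + p.2))%R]| =
    \sum_(j < 6 * m) #|large_gaps (m + j)|)%N.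
  rewrite -sum1dep_card.
  under [RHS]eq_bigr do rewrite -sum1dep_card.
  rewrite pair_big_dep /=; apply: eq_bigl => -[j i] /=; by rewrite !inE.
move: (\sum_(_ < _) _)%N (\sum_(_ < _) _)%N => h e; rewrite -mulnn; nia.
Qed.

(** [j] is chosen before [S] because [S] will be the sumset built from x_j and x_(j+1). The factor
    [s] undoes a reflection of A. *)
Lemma card_squeezed (s : R) : s != 0 -> (0 < m)%N ->
  exists2 j, (j < 7 * m)%N & forall S : {fset R},
    (forall i k l, (i <= 7 * m)%N -> (k <= 7 * m)%N -> (l < 7 * m)%N ->
      s * (f j (x i) + g j (x k) + d j l) \in S) ->
    (3 * m ^ 3 <= 16 * #|` S|)%N.
Proof.
move=> s0 m0; have [j j7 jP] := exists_good_gap m0.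
exists j => // S SP.
have := card_first_indices j.
have := card_sqr_le_ordered_pairs (fun l : 'I_m => d j l) (first_indices j).
set P2 := [set p in _ | _].
pose u (t : 'I_(6 * m) * ('I_m * 'I_m)) :=
  s * (f j (x (m + t.1)%N) + g j (x t.2.2) + d j t.2.1).
pose P := setX (large_gaps j) P2.
have k7 (k : 'I_m) : (k < 7 * m)%N by have := ltn_ord k; lia.
have i7 (i : 'I_(6 * m)) : (m + i < 7 * m)%N by have := ltn_ord i; lia.
have g_le k l : (k <= l <= 7 * m)%N -> g j (x k) <= g j (x l).
  move=> /andP[+ l7]; elim: l l7 => [|l IHl] l7.
    by rewrite leqn0 => /eqP->.
  rewrite leq_eqVlt => /predU1P[-> //|kl]; apply: le_trans (IHl _ _) _ => //.
    exact: ltnW.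
  by rewrite -subr_ge0; apply/ltW/d_gt0.
have f_le k l : (k <= l <= 7 * m)%N -> f j (x k) <= f j (x l).
  move=> kl; apply: f_mono; rewrite ?x_le //; first exact: ltnW.
  by apply: x_ge0; lia.
have g_gap (k l : 'I_m) : d j l <= d j k ->
    g j (x k) < g j (x k) + d j l <= g j (x k.+1).
  move=> dlk; rewrite ltrDl d_gt0 //=.
  by rewrite -[leRHS](subrKC (g j (x k))) lerD2l.
have g_ge0 k : (k <= 7 * m)%N -> 0 <= g j (x k).
  move=> km; rewrite subr_ge0 /f lerXn2r ?nnegrE ?addr_ge0 ?x_ge0 //.
  - exact: ltnW.
  - by rewrite lerD2r x_le // leqnSn.
have f_gap (i : 'I_(6 * m)) (k l : 'I_m) :
    i \in large_gaps j -> d j l <= d j k ->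
    f j (x (m + i)%N) < f j (x (m + i)%N) + (g j (x k) + d j l)
      <= f j (x (m + i).+1).
  rewrite inE => ij dlk; have /andP[lo hi] := g_gap _ _ dlk.
  rewrite ltrDl (le_lt_trans (g_ge0 _ (ltnW (k7 k))) lo) /=.
  rewrite addrC -lerBrDr (le_trans hi) //.
  (* Since k + 1 <= m + i, it suffices to bound g(x_(m+i)). That amounts to x_(j+1) + x_(m+i) <= x_j
     + x_(m+i+1), which is the large gap condition. *)
  apply: le_trans (g_le _ (m + i)%N _) _.
    by have := i7 i; have := ltn_ord k; lia.
  have xi0 : 0 <= x (m + i)%N by apply/x_ge0/ltnW.
  rewrite lerD2r /f lerXn2r ?nnegrE ?addr_ge0 ?x_ge0 //;
    rewrite ?(ltnW j7) ?(ltnW (i7 i)) //.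
  by move: ij; rewrite /gap; lra.
have u_inj : {in P &, injective u}.
  move=> [i [l k]] [i' [l' k']]; rewrite /P /P2 !in_setX !in_set /=.
  rewrite -!andbA => /and4P[iL lI _ dlk] /and4P[i'L l'I _ dlk'].
  rewrite /u /= => /(mulfI s0) uE'.
  have uE : f j (x (m + i)%N) + (g j (x k) + d j l) =
      f j (x (m + i')%N) + (g j (x k') + d j l').
    by rewrite [LHS]addrA [RHS]addrA.
  have /addnI/val_inj ii' : (m + i = m + i')%N.
    apply: (eq_index_of_mem_gap (w := f j \o x) f_le) (f_gap i k l _ _) _ => //.
    - by rewrite inE.
    - by rewrite uE f_gap ?inE.
  move: uE; rewrite ii' => /addrI gE.
  have /val_inj kk' : k = k' :> nat.
    apply: (eq_index_of_mem_gap (w := g j \o x) g_le) (g_gap k l _) _ => //.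
    by rewrite gE g_gap.
  move: gE; rewrite kk' => /addrI dE; congr (_, (_, _)); apply: val_inj.
  have [ll'|l'l|//] := ltngtP l l'.
  - by move: l'I => /forallP/(_ l); rewrite ll' dE eqxx.
  - by move: lI => /forallP/(_ l'); rewrite l'l dE eqxx.
have : (#|P| <= #|` S|)%N.
  rewrite cardE -(size_map u); apply: uniq_leq_size.
    rewrite map_inj_in_uniq ?enum_uniq // => t t'; rewrite !mem_enum.
    exact: u_inj.
  move=> _ /mapP[[i [l k]] _ ->]; apply: SP => //=; exact: ltnW.
have : (#|large_gaps j| <= 6 * m)%N.
  by rewrite -[leqRHS](card_ord (6 * m)) max_card.
rewrite cardsX.
move: jP; move: #|` S| #|large_gaps j| #|P2|.
move: #|first_indices j| #|coincidences j|.
move=> c1 e cS h p2 eh h6 hp sq cI.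
(* From h <= 6m and the choice of [j], 18e <= 9m; so at least half of the indices are first indices.
   The choice of [j] also gives 2h >= 3m. *)
have sq' : (m ^ 2 <= 8 * p2)%N.
  have : (m ^ 2 <= (2 * c1) ^ 2)%N by rewrite leq_sqr; lia.
  by rewrite expnMn; lia.
have : (3 * m * m ^ 2 <= 2 * h * (8 * p2))%N by apply: leq_mul; lia.
by rewrite -mulnA -expnS; lia.
Qed.

End Squeezing.

(** * Transfer to an arbitrary finite set *)

Definition seven_fold (R : realType) (a a' : R) (A : {fset R}) :=
  (dblset (cubes a A) :+: dblset (cubes a' A)
     :-: dblset (cubes a A) :-: cubes a' A).

Lemma mem_seven_fold (R : realType) (a a' : R) (A : {fset R})
    (y1 y2 y3 y4 y5 y6 y7 : R) :
  y1 \in A -> y2 \in A -> y3 \in A -> y4 \in A ->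
  y5 \in A -> y6 \in A -> y7 \in A ->
  (a + y1) ^+ 3 + (a + y2) ^+ 3 + ((a' + y3) ^+ 3 + (a' + y4) ^+ 3)
    - ((a + y5) ^+ 3 + (a + y6) ^+ 3) - (a' + y7) ^+ 3 \in seven_fold a a' A.
Proof.
move=> A1 A2 A3 A4 A5 A6 A7.
by do !(apply: in_imfset2 => //=); apply: in_imfset.
Qed.

Lemma card_nonneg_or_nonpos (R : realType) (A : {fset R}) :
  exists (s : R) (B : {fset R}), [/\ s * s = 1, {subset B <= A},
    {in B, forall y, 0 <= s * y} & (#|` A| <= 2 * #|` B|)%N].
Proof.
pose B (s : R) := [fset y in A | (0 <= s * y)%R].
have BP s : {subset B s <= A} /\ {in B s, forall y, 0 <= s * y}.
  by split=> y; rewrite !inE => /andP[].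
have : (#|` A| <= #|` B 1%R| + #|` B (-1)%R|)%N.
  apply: leq_trans (leq_card_fsetU _ _).
  apply/fsubset_leq_card/fsubsetP => y yA.
  by rewrite !inE yA mul1r mulN1r oppr_ge0 /= le_total.
have [B1A B1_ge0] := BP 1; have [BNA BN_ge0] := BP (-1).
clearbody B => cA; have [cle|/ltnW cle] := leqP #|` B (-1)%R| #|` B 1%R|.
- by exists 1, (B 1); split; rewrite ?mulr1 //; lia.
- by exists (-1), (B (-1)); split; rewrite ?mulrNN ?mulr1 //; lia.
Qed.

Lemma card_seven_fold_cubic (R : realType) (A : {fset R}) : (0 < #|` A|)%N ->
  exists a a' : R, [/\ a \in A, a' \in A &
    (#|` A| ^ 3 <= 56 ^ 3 * #|` seven_fold a a' A|)%N].
Proof.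
move=> A0; have [s [B [s2 BA B_ge0 cA]]] := card_nonneg_or_nonpos A.
have s0 : s != 0 by apply/eqP => s0; move: s2; rewrite s0 mul0r; lra.
(* The predecessor leaves room for the 7m + 1 points x_0, ..., x_(7m). *)
set m := (#|` B|.-1 %/ 7)%N.
have B_le : (#|` B| <= 7 * m + 7)%N by rewrite /m; lia.
have lt_B : (0 < m -> 7 * m < #|` B|)%N by rewrite /m; lia.
(* If m = 0, then |A| <= 14 and a nonempty sumset is enough. *)
clearbody m; have [m0|m0] := posnP m.
  have /fset0Pn[a aA] : A != fset0 by rewrite -cardfs_gt0.
  exists a, a; split=> //.
  have : (0 < #|` seven_fold a a A|)%N.
    rewrite cardfs_gt0; apply/fset0Pn; eexists.
    by apply: (@mem_seven_fold _ a a A a a a a a a a).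
  move=> /(leq_pmulr (56 ^ 3)%N); apply: leq_trans.
  by rewrite leq_exp2r //; lia.
pose xs := sort <=%O [seq s * y | y <- B].
have size_xs : size xs = #|` B| by rewrite size_sort size_map.
have xs_lt : sorted <%O xs.
  rewrite lt_sorted_uniq_le sort_uniq sort_le_sorted andbT.
  by rewrite map_inj_uniq ?fset_uniq //; exact: mulfI.
pose x := nth 0 xs.
have xB i : (i <= 7 * m)%N -> s * x i \in B.
  move=> im; have : x i \in xs.
    by apply: mem_nth; rewrite size_xs; have := lt_B m0; lia.
  by rewrite mem_sort => /mapP[y yB ->]; rewrite mulrA s2 mul1r.
have x_ge0 i : (i <= 7 * m)%N -> 0 <= x i.
  by move=> /xB/B_ge0; rewrite mulrA s2 mul1r.
have x_lt i j : (i < j <= 7 * m)%N -> x i < x j.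
  move=> /andP[ij jm]; rewrite /x (lt_sorted_ltn_nth 0 xs_lt) //;
  by rewrite inE size_xs; have := lt_B m0; lia.
have xA i : (i <= 7 * m)%N -> s * x i \in A.
  by move=> /xB/BA.
have [j j7 jP] := card_squeezed x_ge0 x_lt s0 m0.
exists (s * x j), (s * x j.+1); split; [exact/xA/ltnW|exact: xA|].
have : (3 * m ^ 3 <= 16 * #|` seven_fold (s * x j) (s * x j.+1) A|)%N.
  apply: jP => i k l i7 k7 l7.
  (* As s^2 = 1, [s] equals its cube and can be moved inside each cube. *)
  have -> (u v w : R) : s * (u + v + w) = s ^+ 3 * (u + v + w).
    by rewrite !exprS expr0 mulr1 s2 mulr1.
  set e := _ * _.
  have -> : e = (s * x j + s * x i) ^+ 3 + (s * x j + s * x l) ^+ 3 +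
     ((s * x j.+1 + s * x k) ^+ 3 + (s * x j.+1 + s * x l.+1) ^+ 3) -
     ((s * x j + s * x k) ^+ 3 + (s * x j + s * x l.+1) ^+ 3) -
     (s * x j.+1 + s * x l) ^+ 3.
    by rewrite /e; ring.
  by apply: mem_seven_fold; apply: xA => //; apply: ltnW.
(* |A| <= 2(7m + 7) <= 28m for m >= 1. The remaining factor 2^3 of 56^3 absorbs 16/3. *)
have : (#|` A| ^ 3 <= (28 * m) ^ 3)%N by rewrite leq_exp2r //; lia.
move=> /leq_trans + m3; apply; rewrite -[56%N]/(28 * 2)%N !expnMn.
by rewrite -mulnA leq_pmul2l ?expn_gt0 //; lia.
Qed.

Theorem corollary1p3 (R : realType) :
  exists C c : R, 0 < C /\ 0 < c /\
    forall A : {fset R}, (2 <= #|` A|)%N ->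
      exists a a' : R, a \in A /\ a' \in A /\
        gtrsim C c
          (#|` (dblset (cubes a A) :+: dblset (cubes a' A)
                :-: dblset (cubes a A) :-: cubes a' A)%fset |)%:R
          ((#|` A|)%:R `^ (5 / 2)).
Proof.
(* |A| >= 2 makes the logarithm at least 1, so dividing by it only lowers the bound, and |A|^(5/2)
   <= |A|^3. *)
exists (56 ^+ 3)^-1, 1; do 2?split; rewrite ?invr_gt0 ?exprn_gt0 //.
move=> A A2; have A0 : (0 < #|` A|)%N by exact: leq_trans A2.
have [a [a' [aA a'A cS]]] := card_seven_fold_cubic A0.
exists a, a'; do 2!split=> //; rewrite /gtrsim.
set N := #|` A|%:R : R; set y := N `^ _.
have N2 : 2 <= N by rewrite /N ler_nat.
have N1 : 1 <= N by rewrite /N ler1n.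
have y_ge2 : 2 <= y.
  apply: le_trans N2 _; rewrite -[leLHS]powRr1 ?ler0n //.
  by rewrite /y ler_powR //; lra.
have log_ge1 : 1 <= log2 y.
  have ln2 : 0 < ln 2 :> R by rewrite ln_gt0 // ltr1n.
  by rewrite /log2 ler_pdivlMr // mul1r ler_ln ?posrE //; lra.
rewrite powRr1; last lra.
apply: le_trans (_ : (56 ^+ 3)^-1 * y <= _).
  rewrite ler_pdivrMr; last lra.
  by rewrite ler_peMr // mulr_ge0 ?invr_ge0 //; lra.
rewrite mulrC ler_pdivrMr ?exprn_gt0 // mulrC.
apply: le_trans (_ : N ^+ 3 <= _).
  by rewrite -powR_mulrn ?ler0n // /y ler_powR //; lra.
by rewrite /N -!natrX -natrM ler_nat.
Qed.
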